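(* For every (finite) distributive lattice $L$, the VC-dimension of $L$ equals its Euclidean dimension: $\mathrm{VC\text{-}dim}(L)=\dim_{\mathbb{E}}(L)$.
   Context: A finite distributive lattice $L$ is viewed as a set family via Birkhoff's theorem: $L$ is identified with the family $\mathcal{D}_P\subseteq 2^U$ of all ideals (downward closed subsets) of the poset $P=(U,\leq)$ of its join-irreducible elements. The VC-dimension of a family $\mathcal{S}\subseteq 2^U$ is the maximum size of $X\subseteq U$ with $\{S\cap X:S\in\mathcal{S}\}=2^X$. A realization of a family $\mathcal{S}\subseteq 2^U$ in $\mathbb{R}^m$ consists of oriented affine hyperplanes $(H_e)_{e\in U}$ of $\mathbb{R}^m$, where $H_e=\{x:a_e\cdot x=b_e\}$ with $a_e\neq 0$, $H_e^+=\{x:a_e\cdot x>b_e\}$, $H_e^-=\{x:a_e\cdot x<b_e\}$, and a relatively open convex set $K\subseteq\mathbb{R}^m$ such that $X\subseteq U$ belongs to $\mathcal{S}$ if and only if there is $x\in K$ with $x\in H_e^+$ for all $e\in X$ and $x\in H_e^-$ for all $e\in U\setminus X$. The Euclidean dimension $\dim_{\mathbb{E}}(\mathcal{S})$ is the smallest $m$ such that $\mathcal{S}$ has a realization in $\mathbb{R}^m$. *)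

(* Defs.v *)
From HB Require Import structures.
From mathcomp Require Import all_boot all_order all_algebra.
From mathcomp Require Import boolp classical_sets reals topology normedtype convex.

Set Implicit Arguments.
Unset Strict Implicit.
Unset Printing Implicit Defensive.

Import Order.TTheory GRing.Theory Num.Theory.
Import numFieldNormedType.Exports.

Local Open Scope ring_scope.

Section JoinIrreducibles.
Variables (d : Order.disp_t) (L : finTBDistrLatticeType d).

Definition join_irreducible (x : L) : bool :=
  (x != \bot)%O &&
  [forall y : L, forall z : L, (x == y `|` z)%O ==> (x == y) || (x == z)].

Definition join_irr : Type := {x : L | join_irreducible x}.

HB.instance Definition _ := SubFinite.copy join_irr {x : L | join_irreducible x}.
HB.instance Definition _ := [SubChoice_isSubPOrder of join_irr by <: with d].

End JoinIrreducibles.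

Section Ideals.
Variables (d : Order.disp_t) (P : finPOrderType d).

Definition is_ideal (I : {set P}) : bool :=
  [forall x in I, forall y : P, (y <= x)%O ==> (y \in I)].

Definition ideals : {set {set P}} := [set I : {set P} | is_ideal I].

End Ideals.

(* The set family representing L under Birkhoff's theorem. *)
Definition birkhoff_family (d : Order.disp_t) (L : finTBDistrLatticeType d) :
    {set {set join_irr L}} :=
  ideals (join_irr L).

Section VCDimension.
Variable U : finType.

Definition shatters (S : {set {set U}}) (X : {set U}) : bool :=
  [set A :&: X | A in S] == powerset X.

(* The maximum is over a nonempty range as soon as S is nonempty; for S empty
   the value is the junk value 0. *)
Definition vc_dim (S : {set {set U}}) : nat :=
  \max_(X : {set U} | shatters S X) #|X|.

End VCDimension.

Section EuclideanDimension.
Variable R : realType.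

Definition dotp m (a x : 'rV[R]_m) : R := \sum_i a 0 i * x 0 i.

Definition affine_hull m (K : set 'rV[R]_m) : set 'rV[R]_m :=
  [set x | exists n (t : 'I_n -> R) (y : 'I_n -> 'rV[R]_m),
     [/\ forall i, K (y i), \sum_i t i = 1 & x = \sum_i t i *: y i]]%classic.

Definition relatively_open m (K : set 'rV[R]_m) : Prop :=
  exists2 O : set 'rV[R]_m, open O & K = (O `&` affine_hull K)%classic.

Definition pos_side m (a : 'rV[R]_m) (b : R) : set 'rV[R]_m :=
  [set x | b < dotp a x]%classic.

Definition neg_side m (a : 'rV[R]_m) (b : R) : set 'rV[R]_m :=
  [set x | dotp a x < b]%classic.

Definition realization (U : finType) (S : {set {set U}}) m
    (a : U -> 'rV[R]_m) (b : U -> R) (K : set 'rV[R]_m) : Prop :=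
  [/\ forall e, a e != 0,
      relatively_open K,
      convex_set K
    & forall X : {set U}, X \in S <->
        exists2 x, K x &
          (forall e, e \in X -> pos_side (a e) (b e) x) /\
          (forall e, e \notin X -> neg_side (a e) (b e) x)].

Definition realizable (U : finType) (S : {set {set U}}) (m : nat) : Prop :=
  exists (a : U -> 'rV[R]_m) (b : U -> R) (K : set 'rV[R]_m),
    realization S a b K.

(* Relational form, since a family need not be realizable in any dimension:
   m is the Euclidean dimension of S. *)
Definition is_euclidean_dim (U : finType) (S : {set {set U}}) (m : nat) : Prop :=
  realizable S m /\ forall m', realizable S m' -> (m <= m')%N.

End EuclideanDimension.

(* Main.v *)
(** Antichains of the poset P of join-irreducibles are shattered by its ideals,
so by Dilworth's theorem P is covered by m chains, m being the VC-dimension.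
In R^m, the elements of the i-th chain get hyperplanes orthogonal to the i-th
axis, ordered along the axis as in the chain.  Each pair e < f costs one linear
inequality cutting off the quadrant "above H_f, below H_e"; if the thresholds
accumulate fast enough along a linear extension of P, these inequalities spare
a point of the cell of every ideal, and the open polyhedron they define is K.
Conversely, m + 1 hyperplanes in R^m have linearly dependent normals, hence miss
a sign pattern. *)

Require Import Defs.
From mathcomp Require Import boolp classical_sets filter reals topology normedtype convex.
From mathcomp Require Import unstable interval_inference.
From mathcomp Require Import all_boot all_order all_algebra.
From mathcomp Require Import ring lra.

Set Implicit Arguments.
Unset Strict Implicit.
Unset Printing Implicit Defensive.

Import Order.TTheory GRing.Theory Num.Theory.
Import numFieldNormedType.Exports.

(** * Dilworth's theorem *)

Definition antichain (d : Order.disp_t) (P : finPOrderType d) (B : {set P}) : bool :=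
  [forall x in B, forall y in B, (x <= y)%O ==> (x == y)].

Lemma antichainP (d : Order.disp_t) (P : finPOrderType d) (B : {set P}) :
  reflect {in B &, forall x y : P, (x <= y)%O -> x = y} (antichain B).
Proof.
apply: (iffP forall_inP) => [acB x y xB yB xy|acB x xB].
  by move/forall_inP: (acB x xB) => /(_ y yB) /implyP /(_ xy) /eqP.
by apply/forall_inP => y yB; apply/implyP => xy; apply/eqP/acB.
Qed.

(** A cover of [A] by chains; colors outside [A] are free, so colorings of subsets can be glued. *)
Definition chain_coloring (d : Order.disp_t) (P : finPOrderType d) (A : {set P})
    (c : P -> nat) : Prop :=
  {in A &, forall x y, c x = c y -> (x >=< y)%O}.

Lemma exists_maximal (d : Order.disp_t) (P : finPOrderType d) (A : {set P}) (x0 : P) :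
  x0 \in A -> exists2 a, a \in A & {in A, forall y, ~~ (a < y)%O}.
Proof.
(* The number of elements below a point strictly increases along the order, so maximizing it gives a
   maximal element. *)
move=> x0A; case: (arg_maxnP (fun x : P => #|[set y | (y < x)%O]|) x0A) => a aA amax.
exists a => // y yA; apply/negP => ay.
have : #|[set z | (z < y)%O]| <= #|[set z | (z < a)%O]| := amax y yA.
apply/negP; rewrite -ltnNge; apply: proper_card.
apply/properP; split; first by apply/subsetP => z; rewrite !inE => /lt_trans; apply.
by exists a; rewrite !inE ?ltxx.
Qed.

Lemma chain_color_inj (d : Order.disp_t) (P : finPOrderType d) (A B : {set P})
    (c : P -> nat) :
  chain_coloring A c -> B \subset A -> antichain B -> {in B &, injective c}.
Proof.
move=> cA /subsetP BA /antichainP acB x y xB yB /(cA _ _ (BA _ xB) (BA _ yB)).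
by rewrite /Order.comparable => /orP[/(acB _ _ xB yB)|/(acB _ _ yB xB)].
Qed.

(** Pigeonhole: [c] is injective on an antichain, so [k] elements exhaust the [k] colors. *)
Lemma chain_color_surj (d : Order.disp_t) (P : finPOrderType d) (A B : {set P})
    (c : P -> nat) (k : nat) :
  chain_coloring A c -> {in A, forall x, c x < k} -> B \subset A ->
  antichain B -> #|B| = k -> forall i, i < k -> exists2 y, y \in B & c y = i.
Proof.
move=> cA ck sBA acB cardB i ik; have cinj := chain_color_inj cA sBA acB.
case: k ck cardB ik => // k ck cardB ik.
have cok y : y \in B -> c y < k.+1 by move=> /(subsetP sBA) /ck.
have : [set (inord (c y) : 'I_k.+1) | y in B] == [set: 'I_k.+1].
  rewrite eqEcard subsetT cardsT card_ord card_in_imset ?cardB ?leqnn //.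
  by move=> x y xB yB /(congr1 val); rewrite /= !inordK ?cok // => /cinj; apply.
move=> /eqP/setP/(_ (inord i)); rewrite inE => /imsetP[y yB /(congr1 val) /=].
by rewrite !inordK ?cok // => ->; exists y.
Qed.

Section TopOfChains.

Variables (d : Order.disp_t) (P : finPOrderType d) (A : {set P}) (c : P -> nat) (k : nat).
Hypothesis cA : chain_coloring A c.
Hypothesis ck : {in A, forall x, c x < k}.

(** The [k] colors bound antichains of [A] by [k], so those with [k] elements are maximum. *)
Let max_antichain (B : {set P}) : bool := [&& B \subset A, antichain B & #|B| == k].

Let met : {set P} := [set z | [exists B : {set P}, max_antichain B && (z \in B)]].

Definition chain_tops : {set P} :=
  [set z in met | [forall z' in met, (c z' == c z) ==> (z' <= z)%O]].

Let metP z : reflect (exists2 B, max_antichain B & z \in B) (z \in met).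
Proof.
rewrite inE; apply: (iffP existsP) => [[B /andP[]]|[B mB zB]]; first by exists B.
by exists B; rewrite mB.
Qed.

Let met_sub : met \subset A.
Proof. by apply/subsetP => z /metP[B /and3P[/subsetP BA _ _] /BA]. Qed.

Lemma chain_tops_sub : chain_tops \subset A.
Proof. by apply/subsetP => z; rewrite inE => /andP[/(subsetP met_sub)]. Qed.

Lemma chain_topsP x y (B : {set P}) : x \in chain_tops ->
  B \subset A -> antichain B -> #|B| = k -> y \in B -> c y = c x -> (y <= x)%O.
Proof.
rewrite inE => /andP[_ /forall_inP xtop] sB acB cB yB cyx.
apply: (implyP (xtop y _)); last exact/eqP.
by apply/metP; exists B => //; rewrite /max_antichain sB acB cB eqxx.
Qed.

(* If x <= y are tops of different chains, the antichain through y meets the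
   chain of x at a point below x, hence below y. *)
Lemma chain_tops_antichain : antichain chain_tops.
Proof.
apply/antichainP => x y xT yT xy.
have /metP[B /and3P[sB acB /eqP cB] yB] : y \in met by move: yT; rewrite inE => /andP[].
have xA := subsetP chain_tops_sub _ xT.
have [z zB czx] := chain_color_surj cA ck sB acB cB (ck xA).
have zx := chain_topsP xT sB acB cB zB czx.
have ezy := antichainP _ acB _ _ zB yB (le_trans zx xy).
by apply/le_anti; rewrite xy -ezy zx.
Qed.

(** Each of the [k] chains meets [B], hence has a top, and tops of different colors are distinct. *)
Lemma card_chain_tops (B : {set P}) :
  B \subset A -> antichain B -> #|B| = k -> k <= #|chain_tops|.
Proof.
move=> sB acB cB.
have top (i : 'I_k) : exists x, (x \in chain_tops) && (c x == i).
  have [y yB cy] := chain_color_surj cA ck sB acB cB (ltn_ord i).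
  have yM : y \in [set z in met | c z == i].
    by rewrite inE cy eqxx andbT; apply/metP; exists B => //; rewrite /max_antichain sB acB cB eqxx.
  have [x] := exists_maximal yM; rewrite inE => /andP[xM /eqP cx] xmax.
  exists x; rewrite inE xM cx eqxx andbT; apply/forall_inP => z zM.
  apply/implyP => cz; have : ~~ (x < z)%O by apply: xmax; rewrite inE zM.
  (* Inside one chain, maximal means greatest. *)
  have /orP[xz|//] : (x >=< z)%O.
    by apply: cA; rewrite ?(subsetP met_sub) // cx (eqP cz).
  by rewrite lt_neqAle xz andbT negbK => /eqP ->.
pose f i := xchoose (top i).
have fP i : f i \in chain_tops /\ c (f i) = i by have /andP[? /eqP] := xchooseP (top i).
have finj : injective f by move=> i j /(congr1 c); rewrite !(proj2 (fP _)) => /val_inj.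
rewrite -{1}[k]card_ord -cardsT -(card_imset _ finj); apply: subset_leq_card.
by apply/subsetP => _ /imsetP[i _ ->]; exact: (fP i).1.
Qed.

End TopOfChains.

(* Galvin's induction: remove a maximal element a of A, color the rest
   optimally, and compare a with the tops of the color classes. *)
Theorem dilworth_in (d : Order.disp_t) (P : finPOrderType d) (A : {set P}) (m : nat) :
  (forall B : {set P}, B \subset A -> antichain B -> #|B| <= m) ->
  exists2 c : P -> nat, chain_coloring A c & {in A, forall x, c x < m}.
Proof.
have [n] := ubnP #|A|; elim: n => // n IHn in A m *; rewrite ltnS => cardA wA.
have [->|[x0 x0A]] := set_0Vmem A; first by exists (fun=> 0) => x; rewrite inE.
have [a aA amax] := exists_maximal x0A.
pose A' := A :\ a; pose ac (B : {set P}) := (B \subset A') && antichain B.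
have sA' : A' \subset A by exact: subsetDl.
have ac0 : ac set0 by rewrite /ac sub0set; apply/antichainP => x y; rewrite inE.
case: (arg_maxnP (fun B : {set P} => #|B|) ac0) => B0 /andP[sB0 acB0] B0max.
have {}B0max B : ac B -> #|B| <= #|B0| by exact: B0max.
pose k := #|B0|.
have A'lt : #|A'| < n by apply: leq_trans cardA; rewrite (cardsD1 a A) aA.
have [B sB aB|c cA' ck] := IHn A' k A'lt; first by apply: B0max; rewrite /ac sB.
pose X := chain_tops A' c k.
have sX : X \subset A' := chain_tops_sub A' c k.
have [[x /andP[xX xa]]|noX] := pselect (exists x, (x \in X) && (x < a)%O).
  have xA' := subsetP sX _ xX.
  (* Since [x] is below [a], [K] is a chain. *)
  pose K := a |: [set z in A' | (c z == c x) && (z <= x)%O].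
  have kgt0 : 0 < k by apply: leq_ltn_trans (ck _ xA').
  have sAK : A :\: K \subset A'.
    by apply/subsetP => z; rewrite !inE negb_or => /andP[/andP[-> _] ->].
  have AKlt : #|A :\: K| < n := leq_ltn_trans (subset_leq_card sAK) A'lt.
  have [|c' cAK c'k] := IHn _ k.-1 AKlt.
    move=> B sB aB; have sBA' := subset_trans sB sAK.
    rewrite -ltnS prednK // ltn_neqAle B0max ?/ac ?sBA' // andbT; apply/eqP => cB.
    (* An antichain of size [k] avoiding [K] would still meet the chain of [x], at or below [x],
       hence inside [K]. *)
    have [y yB cyx] := chain_color_surj cA' ck sBA' aB cB (ck _ xA').
    have yx := chain_topsP xX sBA' aB cB yB cyx.
    have := subsetP sB _ yB; rewrite in_setD => /andP[/negP[]].
    by rewrite !inE cyx yx eqxx /= andbT -in_setD1 (subsetP sBA') ?orbT.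
  exists (fun z => if z \in K then k.-1 else c' z).
    have KC : {in K, forall z, (z == a) || (c z == c x) && (z \in A')}.
      by move=> z; rewrite !inE => /orP[->//|/and3P[/andP[-> ->] -> _]]; rewrite orbT.
    have Kx : {in K, forall z, (z <= a)%O}.
      move=> z; rewrite !inE => /orP[/eqP -> //|/and3P[_ _ zx]].
      exact: le_trans zx (ltW xa).
    move=> y z yA zA; case: ifPn => yK; case: ifPn => zK cyz.
    - have /orP[/eqP ->|/andP[/eqP cy yA']] := KC _ yK.
        by rewrite /Order.comparable Kx ?orbT.
      have /orP[/eqP ->|/andP[/eqP cz zA']] := KC _ zK.
        by rewrite /Order.comparable Kx.
      by apply: cA'; rewrite ?cy.
    - by have := c'k z; rewrite in_setD zK zA -cyz ltnn => /(_ isT).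
    - by have := c'k y; rewrite in_setD yK yA cyz ltnn => /(_ isT).
    - by apply: cAK; rewrite ?in_setD ?yK ?zK.
  have km : k <= m by apply: wA => //; exact: subset_trans sB0 sA'.
  move=> z zA; case: ifPn => zK; apply: leq_trans km; first by rewrite prednK.
  by apply: leq_trans (c'k z _) (leq_pred _); rewrite in_setD zK.
(* Otherwise [a], maximal and above no top, is incomparable to all of [X]; then [a |: X] is an
   antichain with more than [k] elements, so [k < m] and [a] can have color [k] to itself. *)
have acX : antichain X := chain_tops_antichain cA' ck.
have aX : a \notin X by apply/negP => /(subsetP sX); rewrite !inE eqxx.
have km : k < m.
  apply: leq_ltn_trans (card_chain_tops cA' ck sB0 acB0 erefl) _.
  have <- : #|a |: X| = #|X|.+1 by rewrite cardsU1 aX.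
  apply: wA; first by rewrite subUset sub1set aA (subset_trans sX sA').
  apply/antichainP => y z /setU1P[->|yX] /setU1P[->|zX] yz //.
  - apply/eqP; move: yz; rewrite le_eqVlt => /orP[//|az].
    by case/negP: (amax z (subsetP sA' _ (subsetP sX _ zX))).
  - apply/eqP; move: yz; rewrite le_eqVlt => /orP[//|ya].
    by case: noX; exists y; rewrite yX.
  - exact: (antichainP _ acX).
exists (fun z => if z == a then k else c z).
  move=> y z yA zA; case: eqP => [->|/eqP ya]; case: eqP => [->|/eqP za] cyz //.
  - exact: comparablexx.
  - by have := ck z; rewrite !inE za zA -cyz ltnn => /(_ isT).
  - by have := ck y; rewrite !inE ya yA cyz ltnn => /(_ isT).
  - by apply: cA'; rewrite ?inE ?ya ?za.
move=> z zA; case: eqP => [_ //|/eqP za].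
by apply: ltn_trans km; apply: ck; rewrite !inE za.
Qed.

(** * Shattered sets *)

Local Open Scope ring_scope.

(* More than m normals in R^m satisfy a linear relation, so the same combination
   of the affine forms is constant; a shattered set would give it both signs. *)
Lemma shattered_card_le (R : realType) (U : finType) (S : {set {set U}}) (m : nat)
    (X : {set U}) :
  realizable R S m -> shatters S X -> (#|X| <= m)%N.
Proof.
case=> a [b [K [_ _ _ SP]]] /eqP shX; rewrite leqNgt; apply/negP => ltmX.
pose A : 'M[R]_(#|X|, m) := \matrix_(i, j) a (enum_val i) 0 j.
have /rowV0Pn[v /sub_kermxP vA v0] : kermx A != 0.
  rewrite -mxrank_eq0 mxrank_ker -lt0n subn_gt0.
  exact: leq_ltn_trans (rank_leq_col A) ltmX.
have [i0 vi0] : exists i, v 0 i != 0.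
  by apply/existsP; apply: contraNT v0; rewrite negb_exists => /forallP v0;
     apply/eqP/rowP => i; rewrite mxE; apply/eqP; rewrite -[_ == _]negbK v0.
have dep x : \sum_i v 0 i * (dotp (a (enum_val i)) x - b (enum_val i))
           = - \sum_i v 0 i * b (enum_val i).
  under eq_bigr do rewrite mulrBr.
  rewrite sumrB; rewrite [X in X - _](_ : _ = 0) ?sub0r //.
  transitivity ((v *m A *m x^T) 0 0); last by rewrite vA mul0mx mxE.
  rewrite -mulmxA mxE; apply: eq_bigr => i _; congr (_ * _).
  by rewrite mxE; apply: eq_bigr => j _; rewrite !mxE.
have pattern (s : R) : s != 0 -> exists x, 
    0 < s * \sum_i v 0 i * (dotp (a (enum_val i)) x - b (enum_val i)).
  (* [Y] collects the hyperplanes whose coefficient has the sign of [s]; for a point above exactly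
     these among [X], every summand times [s] is nonnegative. *)
  move=> s0; pose Y := [set enum_val i | i : 'I_#|X| & 0 < s * v 0 i].
  have : Y \in powerset X.
    by rewrite inE; apply/subsetP => _ /imsetP[i _ ->]; exact: enum_valP.
  rewrite -shX => /imsetP[I /SP[x _ [pos neg]] YI]; exists x.
  have memI i : (enum_val i \in I) = (0 < s * v 0 i).
    transitivity (enum_val i \in Y); first by rewrite YI inE enum_valP andbT.
    by rewrite mem_imset ?inE //; exact: enum_val_inj.
  have ge0 i : 0 <= s * (v 0 i * (dotp (a (enum_val i)) x - b (enum_val i))).
    rewrite mulrA; case: (ltrP 0 (s * v 0 i)) => sv.
      by apply: mulr_ge0; rewrite ?subr_ge0 ltW // pos ?memI.
    by apply: mulr_le0; rewrite // subr_le0 ltW // neg ?memI // -leNgt.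
  rewrite mulr_sumr lt0r sumr_ge0 // andbT psumr_neq0 //.
  (* The term of [i0] is nonzero because [x] lies on no hyperplane. *)
  apply/hasP; exists i0; rewrite ?mem_index_enum //= lt0r ge0 andbT !mulf_neq0 //.
  rewrite subr_eq0; case: (boolP (enum_val i0 \in I)) => [/pos|/neg].
    by move=> /gt_eqF ->.
  by move=> /lt_eqF ->.
have N1 : -1 != 0 :> R by rewrite oppr_eq0 oner_neq0.
have [x] := pattern 1 (oner_neq0 _); have [y] := pattern (-1) N1.
rewrite !dep; lra.
Qed.

(** The down-closure of [Y] adds no further element of [X], as distinct elements of [X] are
    incomparable. *)
Lemma shatters_antichain (d : Order.disp_t) (P : finPOrderType d) (X : {set P}) :
  antichain X -> shatters (ideals P) X.
Proof.
move=> /antichainP acX; rewrite /shatters eqEsubset; apply/andP; split; apply/subsetP => Y.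
  by move=> /imsetP[I _ ->]; rewrite inE subsetIr.
rewrite inE => /subsetP YX; apply/imsetP; exists [set z | [exists y in Y, (z <= y)%O]].
  rewrite inE; apply/forall_inP => x; rewrite inE => /exists_inP[y yY xy].
  apply/forallP => z; apply/implyP => zx; rewrite inE; apply/exists_inP.
  by exists y => //; exact: le_trans xy.
apply/setP => x; rewrite !inE; apply/idP/andP => [xY|[/exists_inP[y yY xy] xX]].
  by split; [apply/exists_inP; exists x | exact: YX].
by rewrite (acX x y xX (YX _ yY) xy).
Qed.

(** * Realization from a cover by chains *)

Section ChainRealization.

Variables (R : realType) (d : Order.disp_t) (P : finPOrderType d) (m : nat).
Variable c : P -> 'I_m.
Hypothesis chain_c : forall x y, c x = c y -> (x >=< y)%O.

(** Strictly increasing, it stands in for a linear extension; counting [x] itself keeps it positive,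
    so [(height x).-1] is a true predecessor. *)
Let height (x : P) : nat := #|[set y : P | (y <= x)%O]|.

(* The gap s to the accumulation point 0 shrinks to s^2 / 4: being quadratic,
   this beats the slope s / 2 of the inequalities defining [region]. *)
Fixpoint scale (n : nat) : R := if n is n'.+1 then scale n' ^+ 2 / 4 else 1.

Let threshold (e : P) : R := - scale (height e).

(** A point above [H_f] makes the left side positive, so it must also be above [H_e]. *)
Definition region : set 'rV[R]_m :=
  [set x | forall e f : P, (e < f)%O ->
     2 * (x 0 (c f) - threshold f) < scale (height f).-1 * (x 0 (c e) - threshold e)]%classic.

Let level (I : {set P}) (i : 'I_m) : nat := \max_(e in I | c e == i) height e.

(** Each coordinate is halfway between the last threshold to be passed in its chain and 0. An empty
    maximum gives level 0 and coordinate -1/2, below all thresholds, which are at least -1/4. *)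
Let point (I : {set P}) : 'rV[R]_m := \row_i - (scale (level I i) / 2).

Lemma scale_gt0 n : 0 < scale n.
Proof. by elim: n => //= n IHn; rewrite divr_gt0 ?exprn_gt0. Qed.

Lemma scale_le1 n : scale n <= 1.
Proof. by elim: n => //= n IHn; have := scale_gt0 n; nra. Qed.

Lemma scale_leS n : 4 * scale n.+1 <= scale n.
Proof. by have /= := scale_gt0 n; have := scale_le1 n; nra. Qed.

Lemma scale_le p q : (p <= q)%N -> scale q <= scale p.
Proof.
move=> /subnK <-; elim: (q - p)%N => // n IHn; apply: le_trans IHn.
by have := scale_leS (n + p)%N; have := scale_gt0 (n + p).+1; rewrite addSn; lra.
Qed.

Let height_gt0 x : (0 < height x)%N.
Proof. by apply/card_gt0P; exists x; rewrite inE. Qed.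

Let height_lt x y : (x < y)%O -> (height x < height y)%N.
Proof.
move=> xy; apply: proper_card; apply/properP; split.
  by apply/subsetP => z; rewrite !inE => /le_trans; apply; exact: ltW.
by exists y; rewrite !inE // (lt_geF xy).
Qed.

Let pointE I i : point I 0 i = - (scale (level I i) / 2).
Proof. by rewrite mxE. Qed.

Let point_in (I : {set P}) e : e \in I -> threshold e + scale (height e) / 2 <= point I 0 (c e) < 0.
Proof.
move=> eI; rewrite pointE /threshold; have := scale_gt0 (level I (c e)).
have : scale (level I (c e)) <= scale (height e).
  by apply: scale_le; apply: leq_bigmax_cond; rewrite eI eqxx.
lra.
Qed.

(** As [I] is down-closed, its elements in the chain of [e] lie strictly below [e], so the level is
    at most [(height e).-1]. *)
Let point_notin (I : {set P}) e : is_ideal I -> e \notin I ->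
  -2^-1 <= point I 0 (c e) <= - (scale (height e).-1 / 2).
Proof.
move=> /forall_inP idI eI; rewrite pointE; have := scale_le1 (level I (c e)).
suff : scale (height e).-1 <= scale (level I (c e)) by lra.
apply: scale_le; apply/bigmax_leqP => f /andP[fI /eqP cfe].
rewrite -ltnS prednK //; apply: height_lt.
have /orP[fe|ef] := chain_c cfe.
  by rewrite lt_neqAle fe andbT; apply: contraNneq eI => <-.
by case/negP: eI; move/forallP: (idI f fI) => /(_ e) /implyP; apply.
Qed.

Let pred_height e : scale (height e) = scale (height e).-1 ^+ 2 / 4.
Proof. by rewrite -[in LHS](prednK (height_gt0 e)). Qed.

Let point_region (I : {set P}) : is_ideal I -> region (point I).
Proof.
move=> idI e f ef; have s0 := scale_gt0 (height f).-1; have s1 := scale_le1 (height f).-1.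
have sf := pred_height f; have se0 := scale_gt0 (height e).
have [fI|fI] := boolP (f \in I).
  have eI : e \in I.
    by move/forall_inP: idI => /(_ f fI) /forallP /(_ e) /implyP; apply; exact: ltW.
  have se : scale (height f).-1 <= scale (height e).
    by apply: scale_le; rewrite -ltnS prednK // height_lt.
  (* With [s = scale (height f).-1], the left side is below [s^2 / 2] and the right side is at least
     that. *)
  have /andP[_] := point_in fI; have /andP[+ _] := point_in eI.
  by rewrite /threshold sf; nra.
(* Now the left side is at most [s^2 / 2 - s], hence at most [- s / 2]; the right side exceeds this
   whether or not [e] is in [I]. *)
have /andP[_] := point_notin idI fI.
have [eI|eI] := boolP (e \in I).
  by have /andP[+ _] := point_in eI; rewrite /threshold sf; nra.
by have /andP[+ _] := point_notin idI eI; rewrite /threshold sf; nra.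
Qed.

Let point_sides (I : {set P}) : is_ideal I ->
  (forall e, e \in I -> threshold e < point I 0 (c e)) /\
  (forall e, e \notin I -> point I 0 (c e) < threshold e).
Proof.
move=> idI; split=> e eI.
  by have /andP[+ _] := point_in eI; have := scale_gt0 (height e); lra.
(* By the factor 4, half of the previous gap is still at least twice the gap of [e]. *)
have /andP[_] := point_notin idI eI; have := scale_leS (height e).-1.
by rewrite prednK // /threshold; have := scale_gt0 (height e); lra.
Qed.

Let region_ideal (X : {set P}) (x : 'rV[R]_m) : region x ->
  (forall e, e \in X -> threshold e < x 0 (c e)) ->
  (forall e, e \notin X -> x 0 (c e) < threshold e) -> is_ideal X.
Proof.
move=> Kx pos neg; apply/forall_inP => f fX; apply/forallP => e; apply/implyP.
rewrite le_eqVlt => /orP[/eqP -> //|ef]; apply: contraT => /neg xe.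
have := Kx e f ef; have := pos f fX; have := scale_gt0 (height f).-1; nra.
Qed.

Lemma convex_region : convex_set region.
Proof.
apply/convex_setW => x y /set_mem Kx /set_mem Ky l l0 l1; apply/mem_set => e f ef.
rewrite -subr_gt0 in l1.
have := Ky e f ef; have := Kx e f ef.
rewrite -subr_gt0 => /(mulr_gt0 l0) xpos; rewrite -subr_gt0 => /(mulr_gt0 l1) ypos.
rewrite -subr_gt0; move: (addr_gt0 xpos ypos); rewrite !mxE /onem.
by congr (0 < _); ring.
Qed.

Lemma open_region : open region.
Proof.
rewrite openE => x Kx.
pose slack e f (y : 'rV[R]_m) :=
  scale (height f).-1 * (y 0 (c e) - threshold e) - 2 * (y 0 (c f) - threshold f).
have nF : Filter (nbhs x) := nbhs_filter x.
(* There are finitely many pairs, so one neighborhood per pair suffices. *)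
suff near_pair e f : \forall y \near x, (e < f)%O -> 0 < slack e f y.
  have near_all := filter_forall nF (fun e => filter_forall nF (near_pair e)).
  by apply: (filterS _ near_all) => y Ky e f ef; rewrite -subr_gt0; exact: Ky.
have [ef|/negbTE nef] := boolP (e < f)%O; last first.
  by apply: (filterS _ (@filterT _ _ nF)) => y; rewrite ?nef.
have slack_cont : {for x, continuous (slack e f)}.
  by apply: cvgB; apply: cvgM; try exact: cvg_cst;
    apply: cvgB; try exact: cvg_cst; exact: coord_continuous.
have /slack_cont : nbhs (slack e f x) [set r : R | 0 < r]%classic.
  apply: open_nbhs_nbhs; split; first exact: open_gt.
  by rewrite /= subr_gt0; exact: Kx.
by move=> near_pos; apply: (filterS (P := [set y | 0 < slack e f y]%classic) _ near_pos) => y.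
Qed.

Lemma chain_realizable : realizable R (ideals P) m.
Proof.
exists (fun e => delta_mx 0 (c e)), threshold, region.
have dotE e x : dotp (delta_mx 0 (c e)) x = x 0 (c e).
  rewrite /dotp (bigD1 (c e)) //= mxE !eqxx mul1r big1 ?addr0 // => i ic.
  by rewrite mxE eqxx (negbTE ic) mul0r.
split.
- move=> e; apply/negP => /eqP/rowP/(_ (c e)); rewrite !mxE !eqxx => /eqP.
  by rewrite oner_eq0.
(* An open set is its own witness, since it lies in its affine hull by one-term combinations. *)
- exists region; first exact: open_region.
  apply/seteqP; split=> [x Kx|x []//]; split=> //.
  exists 1%N, (fun=> 1), (fun=> x); split=> //; first by rewrite big_ord1.
  by rewrite big_ord1 scale1r.
- exact: convex_region.
- move=> X; rewrite inE; split=> [idX|[x Kx [pos neg]]].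
    have [pos neg] := point_sides idX; exists (point X); first exact: point_region.
    by split=> e eX; rewrite /pos_side /neg_side /= dotE; [exact: pos|exact: neg].
  by apply: (region_ideal Kx) => e eX; rewrite -dotE; [exact: pos|exact: neg].
Qed.

End ChainRealization.

Theorem corollary38 (R : realType) (d : Order.disp_t)
    (L : finTBDistrLatticeType d) :
  is_euclidean_dim R (birkhoff_family L) (vc_dim (birkhoff_family L)).
Proof.
split; last first.
  by move=> m real_m; apply/bigmax_leqP => X; exact: (shattered_card_le real_m).
have [B _ acB|c cchain cw] :=
    @dilworth_in d (join_irr L) [set: join_irr L] (vc_dim (birkhoff_family L)).
  apply: leq_bigmax_cond; exact: shatters_antichain.
pose c' x := Ordinal (cw x (in_setT x)).
apply: (@chain_realizable R d (join_irr L) _ c') => x y [].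
exact: cchain.
Qed.
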